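(* Let $C$ be the cost Hamiltonian of a cost function $c:\{0,1\}^n\to\mathbb{R}$, let $p\ge1$ and $\gamma_1,\beta_1,\dots,\gamma_p,\beta_p\in\mathbb{R}$. The QAOA$_p$ operator $Q=Q_pQ_{p-1}\cdots Q_2Q_1$, where $Q_j=e^{-i\beta_jB}e^{-i\gamma_jC}$, acts by conjugation on $C$ as $$Q^\dagger CQ=\sum_{\ell_1=0}^\infty\sum_{k_1=0}^\infty\cdots\sum_{\ell_p=0}^\infty\sum_{k_p=0}^\infty\frac{(i\gamma_1\nabla_C)^{\ell_1}(i\beta_1\nabla)^{k_1}\cdots(i\gamma_p\nabla_C)^{\ell_p}(i\beta_p\nabla)^{k_p}}{\ell_1!\,k_1!\,\ell_2!\,k_2!\cdots\ell_p!\,k_p!}\,C .$$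
   Context: Work on $n$ qubits. The cost Hamiltonian is $C=\sum_{x\in\{0,1\}^n}c(x)|x\rangle\langle x|$ and the mixing Hamiltonian is $B=\sum_{j=1}^nX_j$ with $X_j$ the Pauli $X$ on qubit $j$. The superoperators are $\nabla A=[B,A]$ and $\nabla_CA=[C,A]$; products are compositions, with the rightmost factor acting first on $C$. *)

(* Defs.v *)
From HB Require Import structures.
From mathcomp Require Import all_boot all_order all_algebra.
From mathcomp Require Import spectral complex.
From mathcomp Require Import all_classical all_reals all_analysis.

Set Implicit Arguments.
Unset Strict Implicit.
Unset Printing Implicit Defensive.

Import Order.TTheory GRing.Theory Num.Theory.
Import numFieldNormedType.Exports.

Local Open Scope classical_set_scope.
Local Open Scope ring_scope.

(* Packing R[i] as a numClosedFieldType makes the library's norm and topology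
   on numeric closed fields, and hence on matrices over them, available. *)
Definition Cx (R : realType) : numClosedFieldType := R[i].

Definition toCx (R : realType) (r : R) : Cx R := real_complex R r.

Definition bits (n : nat) := {ffun 'I_n -> 'I_2}.

(* Operators on n qubits, as matrices in the computational basis: row and
   column numbers stand for bit strings through enum_rank and enum_val. *)
Definition op (R : realType) (n : nat) := 'M[Cx R]_(#|{: bits n}|).

Definition ket (R : realType) (n : nat) (x : bits n)
    : 'cV[Cx R]_(#|{: bits n}|) :=
  delta_mx (enum_rank x) 0.

Definition adjoint (R : realType) (m n : nat) (A : 'M[Cx R]_(m, n))
    : 'M[Cx R]_(n, m) :=
  (A ^t*)%sesqui.

Definition cost_hamiltonian (R : realType) (n : nat) (c : bits n -> R)
    : op R n :=
  \sum_(x : bits n) toCx (c x) *: (ket R x *m adjoint (ket R x)).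

Definition pauliX (R : realType) : 'M[Cx R]_2 := \matrix_(a, b) (a != b)%:R.

(* Kronecker product U_0 (x) ... (x) U_(n-1) of one-qubit operators. *)
Definition tensor (R : realType) (n : nat) (U : 'I_n -> 'M[Cx R]_2)
    : op R n :=
  \matrix_(y, x)
    \prod_(k < n) U k ((enum_val y : bits n) k) ((enum_val x : bits n) k).

Definition pauliX_on (R : realType) (n : nat) (j : 'I_n) : op R n :=
  tensor (fun k => if k == j then pauliX R else 1%:M).

Definition mixing_hamiltonian (R : realType) (n : nat) : op R n :=
  \sum_(j < n) pauliX_on R j.

Definition mexp (R : realType) (N : nat) (A : 'M[Cx R]_N) : 'M[Cx R]_N :=
  lim (series (fun k : nat => (k`!%:R)^-1 *: A ^+ k) @ \oo).

Definition superop (R : realType) (n : nat) := op R n -> op R n.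

Definition commutator (R : realType) (n : nat) (H : op R n) : superop R n :=
  fun A => H * A - A * H.

Definition sscale (R : realType) (n : nat) (a : Cx R) (S : superop R n)
    : superop R n :=
  fun A => a *: S A.

Definition spow (R : realType) (n : nat) (S : superop R n) (k : nat)
    : superop R n :=
  iter k S.

(* Layer j : 'I_p is numbered from 0, so gamma j and beta j are the angles
   usually written gamma_(j+1) and beta_(j+1). *)
Definition qaoa_layer (R : realType) (n : nat) (c : bits n -> R)
    (gamma beta : R) : op R n :=
  mexp (- ('i * toCx beta) *: mixing_hamiltonian R n)
  * mexp (- ('i * toCx gamma) *: cost_hamiltonian c).

(* The last layer is the leftmost factor. *)
Definition qaoa (R : realType) (n p : nat) (c : bits n -> R)
    (gamma beta : 'I_p -> R) : op R n :=
  \prod_(j < p) qaoa_layer c (gamma (rev_ord j)) (beta (rev_ord j)).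

(* The first layer is the leftmost factor, so it acts last. *)
Definition qaoa_superop (R : realType) (n p : nat) (c : bits n -> R)
    (gamma beta : 'I_p -> R) (l k : 'I_p -> nat) : superop R n :=
  \big[comp/id]_(j < p)
    (spow (sscale ('i * toCx (gamma j)) (commutator (cost_hamiltonian c))) (l j)
     \o spow (sscale ('i * toCx (beta j)) (commutator (mixing_hamiltonian R n)))
          (k j)).

Definition qaoa_term (R : realType) (n p : nat) (c : bits n -> R)
    (gamma beta : 'I_p -> R) (l k : 'I_p -> nat) : op R n :=
  (\prod_(j < p) ((l j)`!%:R * (k j)`!%:R))^-1
    *: qaoa_superop c gamma beta l k (cost_hamiltonian c).

(* The iterated series sum_(s_0) sum_(s_1) ... sum_(s_(m-1)) F s, whose
   outermost index is the head of s, converges at every level, with sum S. *)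
Fixpoint has_iterated_sum (R : realType) (N m : nat)
    (F : seq nat -> 'M[Cx R]_N) (S : 'M[Cx R]_N) : Prop :=
  if m is m'.+1 then
    exists2 G : nat -> 'M[Cx R]_N,
      forall t, has_iterated_sum m' (fun s => F (t :: s)) (G t)
      & series G @ \oo --> S
  else F [::] = S.

(* Main.v *)
(* A Hermitian H is unitarily equivalent to a real diagonal matrix diag(d), and
   then i r ad_H multiplies the (a,b) entry in that basis by i r (d_a - d_b).
   So the exponential series of i r ad_H converges entrywise, by the scalar
   exponential series, to multiplication by exp(i r (d_a - d_b)), which is
   conjugation by exp(-i r H).  The nested sums are then evaluated from the
   inside out, since each outer term is a linear, hence continuous, map of the
   inner sum. *)
From HB Require Import structures.
Require Import Defs.
From mathcomp Require Import all_boot all_order all_algebra.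
From mathcomp Require Import spectral complex.
From mathcomp Require Import ring.
From mathcomp Require Import all_classical all_reals all_analysis.

Set Implicit Arguments.
Unset Strict Implicit.
Unset Printing Implicit Defensive.

Import Order.TTheory GRing.Theory Num.Theory.
Import numFieldNormedType.Exports.

Local Open Scope classical_set_scope.
Local Open Scope ring_scope.

(** * Unit complex numbers and the scalar exponential series *)

HB.instance Definition _ (R : realType) :=
  GRing.RMorphism.copy (@toCx R) (real_complex R).

Lemma conj_toCx (R : realType) (r : R) : (toCx r)^* = toCx r.
Proof. by apply/CrealP/complex_realP; exists r. Qed.

Lemma toCx_continuous (R : realType) : continuous (@toCx R).
Proof.
move=> x; apply/(@cvgrPdist_lt (Cx R) (Cx R)) => e e0.
(* The norm of [Cx R] takes values in [Cx R], so the radius [e] is a positive complex number, hence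
   the image of a real [d]. *)
have /complex_realP[d de] := gtr0_real e0.
have d0 : 0 < d by rewrite -ltcR -de.
have /cvgrPdist_lt/(_ d d0) : (y @[y --> x] --> x)%classic by exact: cvg_id.
apply: filterS => y xy.
by rewrite -rmorphB /= normc_def /= expr0n addr0 sqrtr_sqr de ltcR.
Qed.

(** This is exp(i r) in Euler's form, which reduces its expansion to the real cosine and sine
    series. *)
Definition phase (R : realType) (r : R) : Cx R :=
  toCx (cos r) + 'i * toCx (sin r).

Lemma phase_series_cvg (R : realType) (r : R) :
  series (fun k => (k`!%:R)^-1 * ('i * toCx r) ^+ k) @ \oo --> phase r.
Proof.
have -> : series (fun k => (k`!%:R)^-1 * ('i * toCx r) ^+ k) =
    (fun n => toCx (series (cos_coeff r) n)
       + 'i * toCx (series (sin_coeff r) n)).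
  apply/funext => n; rewrite /series /= !rmorph_sum /= mulr_sumr -big_split /=.
  apply: eq_bigr => k _; rewrite /cos_coeff /sin_coeff /=.
  rewrite exprMn -exprnP !rmorphM /= !fmorphV !rmorphXn /=.
  rewrite !rmorph_nat !rmorphN !rmorph1.
  (* The parity indicators match those in [cos_coeff] and [sin_coeff]. The truncated predecessor in
     [k.-1./2] is harmless, since that summand vanishes for even [k]. *)
  have -> : 'i ^+ k =
      (~~ odd k)%:R * (-1) ^+ k./2
      + 'i * ((odd k)%:R * (-1) ^+ k.-1./2) :> Cx R.
    rewrite -{1}(odd_double_half k) -muln2 mulnC exprD exprM sqrCi.
    case: (boolP (odd k)) => ok /=.
      rewrite mul0r add0r mul1r expr1; congr (_ * _ ^+ _).
      by rewrite -[in RHS](odd_double_half k) ok /= doubleK.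
    by rewrite mul0r mulr0 addr0 expr0.
  ring.
have cosr : series (cos_coeff r) @ \oo --> cos r.
  by rewrite unlock; exact: is_cvg_series_cos_coeff.
have sinr : series (sin_coeff r) @ \oo --> sin r.
  by rewrite unlock; exact: is_cvg_series_sin_coeff.
apply: cvgD; first exact: cvg_comp cosr (@toCx_continuous R _).
by apply: cvgMl_tmp; exact: cvg_comp sinr (@toCx_continuous R _).
Qed.

Lemma phaseN (R : realType) (r : R) : phase (- r) = (phase r)^*.
Proof.
rewrite /phase cosN sinN rmorphD rmorphM /= conjCi !conj_toCx rmorphN.
by rewrite mulrN mulNr.
Qed.

Lemma phaseD (R : realType) (r s : R) : phase (r + s) = phase r * phase s.
Proof.
rewrite /phase cosD sinD !(rmorphB, rmorphD, rmorphM) /=.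
rewrite !mulrDl !mulrDr !mulrA ![_ * 'i]mulrC !mulrA -expr2 sqrCi.
ring.
Qed.

(** * Convergence of matrix series and linear maps *)

Lemma mx_cvg_entrywise (K : numFieldType) (m n : nat) (u : nat -> 'M[K]_(m, n))
    (M : 'M[K]_(m, n)) :
  (forall i j, u k i j @[k --> \oo] --> M i j) -> u @ \oo --> M.
Proof.
move=> uM; apply/cvg_mx_entourageP => A entA.
apply: filter_forall => i; apply: filter_forall => j.
move: (uM i j) => /cvg_app_entourageP/(_ A entA); apply: filterS => k.
by move=> ?; apply/mem_set.
Qed.

Lemma mx_series_cvg_entrywise (K : numFieldType) (m n : nat)
    (u : nat -> 'M[K]_(m, n)) (M : 'M[K]_(m, n)) :
  (forall i j, series (fun k => u k i j) @ \oo --> M i j) ->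
  series u @ \oo --> M.
Proof.
move=> uM; apply: mx_cvg_entrywise => i j.
rewrite (_ : (fun k => _) = series (fun k => u k i j)) //.
by apply/funext => k; rewrite /series /= summxE.
Qed.

(** Expanding [M] in matrix units turns [f] into a finite sum of coordinate functions times constant
    matrices. *)
Lemma linear_mx_continuous (K : numFieldType) (m n p q : nat)
    (f : 'M[K]_(m, n) -> 'M[K]_(p, q)) : linear f -> continuous f.
Proof.
move=> linf.
pose isf := GRing.isLinear.Build _ _ _ _ f linf.
pose g : {linear 'M[K]_(m, n) -> 'M[K]_(p, q)} := HB.pack f isf.
have -> : f = fun M => \sum_i \sum_j M i j *: f (delta_mx i j).
  apply/funext => M; rewrite {1}[M]matrix_sum_delta.
  rewrite -[f]/(g : _ -> _) linear_sum.
  apply: eq_bigr => i _; rewrite linear_sum.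
  by apply: eq_bigr => j _; rewrite linearZ.
move=> M; apply: cvg_big => [||i _]; first exact: add_continuous.
  exact: nbhs_filter.
apply: cvg_big => [||j _]; first exact: add_continuous.
  exact: nbhs_filter.
apply: cvgZr_tmp; first exact: nbhs_filter.
exact: (@coord_continuous K m n i j M).
Qed.

Lemma linear_series_cvg (K : numFieldType) (m n p q : nat)
    (f : 'M[K]_(m, n) -> 'M[K]_(p, q)) (u : nat -> 'M[K]_(m, n))
    (S : 'M[K]_(m, n)) :
  linear f -> series u @ \oo --> S -> series (f \o u) @ \oo --> f S.
Proof.
move=> linf uS.
pose isf := GRing.isLinear.Build _ _ _ _ f linf.
pose g : {linear 'M[K]_(m, n) -> 'M[K]_(p, q)} := HB.pack f isf.
have -> : series (f \o u) = f \o series u.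
  by apply/funext => k; rewrite /series /= -[f]/(g : _ -> _) linear_sum.
by apply: continuous_cvg => //; exact: linear_mx_continuous.
Qed.

(** By induction on the depth: [f] applies to each inner sum, and then commutes with the outermost
    series by continuity. *)
Lemma has_iterated_sum_linear (R : realType) (N m : nat)
    (F : seq nat -> 'M[Cx R]_N) (S : 'M[Cx R]_N)
    (f : 'M[Cx R]_N -> 'M[Cx R]_N) :
  linear f -> has_iterated_sum m F S -> has_iterated_sum m (f \o F) (f S).
Proof.
move=> linf; elim: m F S => [|m IHm] F S /= => [<- //|[G FG GS]].
exists (f \o G); first by move=> t; exact: (IHm (fun s => F (t :: s))).
exact: linear_series_cvg.
Qed.

(** * Adjoints and diagonalization of Hermitian matrices *)

Lemma adjointE (R : realType) (m n : nat) (A : 'M[Cx R]_(m, n)) i j :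
  adjoint A i j = (A j i)^*.
Proof. by rewrite /adjoint !mxE. Qed.

Lemma adjointM (R : realType) (m n p : nat) (A : 'M[Cx R]_(m, n))
    (B : 'M[Cx R]_(n, p)) : adjoint (A *m B) = adjoint B *m adjoint A.
Proof. by rewrite /adjoint trmx_mul map_mxM. Qed.

Lemma adjointK (R : realType) (m n : nat) (A : 'M[Cx R]_(m, n)) :
  adjoint (adjoint A) = A.
Proof. exact: trmxCK. Qed.

Lemma adjoint_diag (R : realType) (N : nat) (d : 'I_N -> Cx R) :
  adjoint (diag_mx (\row_i d i)) = diag_mx (\row_i (d i)^*).
Proof.
apply/matrixP => i j; rewrite adjointE !mxE rmorphMn /= eq_sym.
by case: eqP => // ->.
Qed.

(** The spectral theorem for normal matrices gives [U]. The eigenvalues of a Hermitian matrix are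
    real, so their real parts serve as [d]. *)
Lemma hermitian_diagonalization (R : realType) (N : nat) (H : 'M[Cx R]_N) :
  adjoint H = H ->
  exists2 U : 'M[Cx R]_N, U *m adjoint U = 1%:M /\ adjoint U *m U = 1%:M
    & exists d : 'I_N -> R, H = adjoint U *m diag_mx (\row_i toCx (d i)) *m U.
Proof.
move=> Hherm.
have hH : H \is hermsymmx.
  apply/is_hermitianmxP.
  by rewrite expr0 scale1r -[RHS]/(adjoint H) Hherm.
have /orthomx_spectralP HE := hermitian_normalmx hH.
have /mxOverP rd := hermitian_spectral_diag_real hH.
have uU := spectral_unitarymx H.
rewrite invmx_unitary // in HE.
exists (spectralmx H).
  split; first exact/unitarymxP.
  by rewrite /adjoint -invmx_unitary // mulVmx // spectral_unit.
exists (fun i => complex.Re (spectral_diag H 0 i)).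
rewrite (_ : \row_i _ = spectral_diag H); first exact: HE.
by apply/rowP => i; rewrite mxE /toCx RRe_real.
Qed.

(** * Powers and exponentials of diagonalized matrices *)

Lemma conjugation_linear (K : comNzRingType) (m n p q : nat) (A : 'M[K]_(m, n))
    (B : 'M[K]_(p, q)) : linear (fun M => A *m M *m B).
Proof. by move=> a M M'; rewrite mulmxDr mulmxDl -scalemxAr -scalemxAl. Qed.

Lemma scale_conj_diag (K : comNzRingType) (N : nat) (U V : 'M[K]_N)
    (d : 'I_N -> K) (a : K) :
  a *: (V *m diag_mx (\row_i d i) *m U) = V *m diag_mx (\row_i (a * d i)) *m U.
Proof.
rewrite scalemxAl scalemxAr -linearZ /=; congr (_ *m diag_mx _ *m _).
by apply/rowP => i; rewrite !mxE.
Qed.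

Lemma expr_conj_diag (K : comNzRingType) (N : nat) (U V : 'M[K]_N)
    (d : 'I_N -> K) k :
  U *m V = 1%:M -> V *m U = 1%:M ->
  (V *m diag_mx (\row_i d i) *m U) ^+ k = V *m diag_mx (\row_i d i ^+ k) *m U.
Proof.
move=> UV VU; elim: k => [|k IHk].
  rewrite (_ : diag_mx _ = 1%:M) ?mulmx1 ?VU //.
  by apply/matrixP => i j; rewrite !mxE expr0.
rewrite exprSr IHk -mulmxE -!mulmxA (mulmxA U) UV mul1mx (mulmxA (diag_mx _)).
rewrite mulmx_diag; congr (_ *m (diag_mx _ *m _)).
by apply/rowP => i; rewrite !mxE exprSr.
Qed.

(** The series lives on the diagonal, and the map sending a row [v] to [V *m diag_mx v *m U] is
    linear, so it suffices to sum the scalar series of exp(-i r d_j) for each j. *)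
Lemma mexp_conj_diag (R : realType) (N : nat) (U V : 'M[Cx R]_N)
    (d : 'I_N -> R) (r : R) :
  U *m V = 1%:M -> V *m U = 1%:M ->
  mexp (- ('i * toCx r) *: (V *m diag_mx (\row_i toCx (d i)) *m U))
  = V *m diag_mx (\row_i (phase (r * d i))^*) *m U.
Proof.
move=> UV VU; apply/cvg_lim => //.
pose u k := \row_i ((k`!%:R)^-1 * (- ('i * toCx r) * toCx (d i)) ^+ k).
rewrite (_ : (fun k : nat => _) =
    (fun v => V *m diag_mx v *m U) \o u); last first.
  apply/funext => k /=.
  by rewrite scale_conj_diag expr_conj_diag // scale_conj_diag.
apply: linear_series_cvg.
  by move=> b v w; rewrite linearP mulmxDr mulmxDl -scalemxAr -scalemxAl.
apply: mx_series_cvg_entrywise => i j; rewrite [X in _ --> X]mxE -phaseN.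
rewrite (_ : (fun k => _) =
    (fun k => (k`!%:R)^-1 * ('i * toCx (- (r * d j))) ^+ k)).
  exact: phase_series_cvg.
apply/funext => k; rewrite mxE rmorphN rmorphM /=.
by rewrite mulrN mulNr mulrA.
Qed.

(** * The exponential series of i r ad_H *)

Definition ad_term (R : realType) (n : nat) (H : op R n) (r : R) (k : nat)
    : superop R n :=
  fun A => (k`!%:R)^-1 *: spow (sscale ('i * toCx r) (commutator H)) k A.

Lemma spow_sscale_commutator_linear (R : realType) (n : nat) (H : op R n)
    (a : Cx R) k : linear (spow (sscale a (commutator H)) k).
Proof.
elim: k => [//|k IHk] b A B.
rewrite /spow /= -/(spow _ k _) -/(spow _ k A) -/(spow _ k B).
rewrite IHk /sscale /commutator -!mulmxE mulmxDr mulmxDl -scalemxAr -scalemxAl.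
by rewrite opprD addrACA -scalerBr scalerDr !scalerA mulrC.
Qed.

Lemma ad_term_linear (R : realType) (n : nat) (H : op R n) (r : R) k :
  linear (ad_term H r k).
Proof.
move=> b A B; rewrite /ad_term spow_sscale_commutator_linear.
by rewrite scalerDr !scalerA mulrC.
Qed.

(** Since [U *m V] cancels, each step keeps the form [V *m M *m U], and the middle factor DM - MD
    has entries (d_i - d_j) M_ij. *)
Lemma iter_commutator_diag (K : comNzRingType) (N : nat) (U V A : 'M[K]_N)
    (d : 'I_N -> K) (a : K) k :
  U *m V = 1%:M ->
  iter k (fun M => a *: (V *m diag_mx (\row_i d i) *m U *m M
                         - M *m (V *m diag_mx (\row_i d i) *m U)))
    (V *m A *m U)
  = V *m (\matrix_(i, j) ((a * (d i - d j)) ^+ k * A i j)) *m U.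
Proof.
move=> UV; elim: k => [|k IHk].
  by congr (_ *m _ *m _); apply/matrixP => i j; rewrite mxE expr0 mul1r.
rewrite iterS IHk; set D := diag_mx _; set M := \matrix_(i, j) _.
have -> : V *m D *m U *m (V *m M *m U) = V *m (D *m M) *m U.
  by rewrite -!mulmxA (mulmxA U) UV mul1mx.
have -> : V *m M *m U *m (V *m D *m U) = V *m (M *m D) *m U.
  by rewrite -!mulmxA (mulmxA U) UV mul1mx.
rewrite -mulmxBl -mulmxBr scalemxAl scalemxAr; congr (_ *m _ *m _).
rewrite mul_diag_mx mul_mx_diag; apply/matrixP => i j; rewrite !mxE exprS.
by set e := _ ^+ k; ring.
Qed.

(** In an eigenbasis of [H], entry (i, j) is multiplied by the series of exp(i r (d_i - d_j)). Its
    sum splits as exp(i r d_i) exp(-i r d_j), one factor for the exponential on each side. *)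
Lemma commutator_series_cvg (R : realType) (N : nat) (H A : 'M[Cx R]_N)
    (r : R) :
  adjoint H = H ->
  series (fun k => (k`!%:R)^-1 *:
      iter k (fun M => ('i * toCx r) *: (H *m M - M *m H)) A) @ \oo
    --> adjoint (mexp (- ('i * toCx r) *: H)) *m A
        *m mexp (- ('i * toCx r) *: H).
Proof.
move=> /hermitian_diagonalization[U [UU' U'U] [d ->]].
rewrite mexp_conj_diag // !adjointM adjointK adjoint_diag.
have -> : \row_i ((phase (r * d i))^*)^* = \row_i phase (r * d i).
  by apply/rowP => i; rewrite mxE [RHS]mxE conjCK.
(* [A'] is [A] written in the eigenbasis. *)
have [A' ->] : exists A', A = adjoint U *m A' *m U.
  exists (U *m A *m adjoint U).
  by rewrite !mulmxA U'U mul1mx -mulmxA U'U mulmx1.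
(* The adjoint of [U] becomes a plain two-sided inverse [V], the form used for diagonalized
   matrices. *)
move: (adjoint U) UU' U'U => V UV VU.
pose u k := \matrix_(i, j)
  ((k`!%:R)^-1 * (('i * toCx r * (toCx (d i) - toCx (d j))) ^+ k * A' i j)).
rewrite (_ : (fun k : nat => _) = (fun M => V *m M *m U) \o u); last first.
  apply/funext => k; rewrite iter_commutator_diag //= scalemxAl scalemxAr.
  rewrite (_ : _ *: _ = u k); first by [].
  by apply/matrixP => i j; rewrite mxE [X in _ * X]mxE [RHS]mxE.
pose E : 'M[Cx R]_N := diag_mx (\row_i phase (r * d i)) *m A'
  *m diag_mx (\row_i (phase (r * d i))^*).
rewrite (_ : _ *m _ = V *m E *m U); last first.
  by rewrite /E -!mulmxA (mulmxA U) UV mul1mx (mulmxA U V) UV mul1mx.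
apply: linear_series_cvg; first exact: conjugation_linear.
apply: mx_series_cvg_entrywise => i j.
rewrite /E mul_mx_diag mul_diag_mx mxE [X in X * _]mxE.
rewrite [X in X * _ * _]mxE [X in _ * _ * X]mxE mulrAC -phaseN -phaseD -mulrBr.
rewrite (_ : series _ = (fun k => series (fun l =>
    (l`!%:R)^-1 * ('i * toCx (r * (d i - d j))) ^+ l) k * A' i j)).
  by apply: cvgMr_tmp; exact: phase_series_cvg.
apply/funext => k; rewrite /series /= mulr_suml.
by apply: eq_bigr => l _; rewrite mxE rmorphM rmorphB !mulrA.
Qed.

Lemma ad_series_cvg (R : realType) (n : nat) (H A : op R n) (r : R) :
  adjoint H = H ->
  series (fun k => ad_term H r k A) @ \oo
    --> adjoint (mexp (- ('i * toCx r) *: H)) * A * mexp (- ('i * toCx r) *: H).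
Proof. exact: commutator_series_cvg. Qed.

(** * Hermiticity of the two Hamiltonians *)

Lemma cost_hamiltonian_hermitian (R : realType) (n : nat) (c : bits n -> R) :
  adjoint (cost_hamiltonian c) = cost_hamiltonian c.
Proof.
apply/matrixP => i j; rewrite adjointE /cost_hamiltonian !summxE rmorph_sum.
apply: eq_bigr => x _; rewrite !mxE rmorphM /= conj_toCx; congr (_ * _).
rewrite rmorph_sum; apply: eq_bigr => k _.
by rewrite rmorphM /= !adjointE conjCK mulrC.
Qed.

Lemma mixing_hamiltonian_hermitian (R : realType) (n : nat) :
  adjoint (mixing_hamiltonian R n) = mixing_hamiltonian R n.
Proof.
apply/matrixP => i j; rewrite adjointE /mixing_hamiltonian !summxE rmorph_sum.
apply: eq_bigr => l _; rewrite !mxE rmorph_prod; apply: eq_bigr => k _.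
by case: ifP => _; rewrite !mxE rmorph_nat eq_sym.
Qed.

(** * Nested sums and the recursion over layers *)

(** This adds one outer index [t]: by linearity the inner sum for fixed [t] is [f t S], which leaves
    a single series to evaluate. *)
Lemma has_iterated_sum_cons (R : realType) (N m : nat)
    (F F' : seq nat -> 'M[Cx R]_N) (S S' : 'M[Cx R]_N)
    (f : nat -> 'M[Cx R]_N -> 'M[Cx R]_N) :
  (forall t, linear (f t)) -> (forall t s, F' (t :: s) = f t (F s)) ->
  has_iterated_sum m F S -> series (fun t => f t S) @ \oo --> S' ->
  has_iterated_sum m.+1 F' S'.
Proof.
move=> linf F'E FS fS; exists (fun t => f t S) => // t.
rewrite (_ : (fun s => _) = f t \o F); first exact: has_iterated_sum_linear.
by apply/funext => s; rewrite F'E.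
Qed.

(** [rev_ord] sends the last index to [ord0], so splitting off the last factor peels off the first
    layer. *)
Lemma prod_rev_ord_recr (T : pzSemiRingType) (p : nat) (F : 'I_p.+1 -> T) :
  \prod_(j < p.+1) F (rev_ord j)
  = (\prod_(j < p) F (lift ord0 (rev_ord j))) * F ord0.
Proof.
rewrite big_ord_recr /=; congr (_ * F _); last by apply/val_inj/subnn.
apply: eq_bigr => j _; congr F; apply/val_inj.
by rewrite /= /bump /= subSS add1n subnSK.
Qed.

Lemma qaoa_recr (R : realType) (n p : nat) (c : bits n -> R)
    (gamma beta : 'I_p.+1 -> R) :
  qaoa c gamma beta =
  qaoa c (gamma \o lift ord0) (beta \o lift ord0)
    * qaoa_layer c (gamma ord0) (beta ord0).
Proof.
exact: (prod_rev_ord_recr (fun j => qaoa_layer c (gamma j) (beta j))).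
Qed.

(** Scalars pass through linear maps. This moves each factorial next to the power it belongs to, so
    that the terms of two separate exponential series appear. *)
Lemma scale_linear_comp (K : fieldType) (V : lmodType K) (f g : V -> V)
    (a b x : K) (v : V) :
  linear f -> linear g ->
  (a * b * x)^-1 *: f (g v) = a^-1 *: f (b^-1 *: g (x^-1 *: v)).
Proof.
move=> linf ling.
pose isf := GRing.isLinear.Build _ _ _ _ f linf.
pose isg := GRing.isLinear.Build _ _ _ _ g ling.
pose F : {linear V -> V} := HB.pack f isf.
pose G : {linear V -> V} := HB.pack g isg.
rewrite -[f]/(F : _ -> _) -[g]/(G : _ -> _) !linearZ /= !scalerA.
by rewrite !invfM -mulrA mulrC.
Qed.

Lemma qaoa_term_recl (R : realType) (n p : nat) (c : bits n -> R)
    (gamma beta : 'I_p.+1 -> R) (l k : 'I_p.+1 -> nat) :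
  qaoa_term c gamma beta l k =
  ad_term (cost_hamiltonian c) (gamma ord0) (l ord0)
    (ad_term (mixing_hamiltonian R n) (beta ord0) (k ord0)
      (qaoa_term c (gamma \o lift ord0) (beta \o lift ord0)
        (l \o lift ord0) (k \o lift ord0))).
Proof.
rewrite /qaoa_term big_ord_recl [qaoa_superop _ _ _ _ _]big_ord_recl.
exact: (scale_linear_comp _ _ _ _
  (spow_sscale_commutator_linear (cost_hamiltonian c)
    ('i * toCx (gamma ord0)) (l ord0))
  (spow_sscale_commutator_linear (mixing_hamiltonian R n)
    ('i * toCx (beta ord0)) (k ord0))).
Qed.

(** Used with [A] the later layers, [B] the mixing exponential and [C] the cost exponential of the
    first layer: the conjugations nest in the order of the sums, cost outermost. *)
Lemma adjoint_conjM (R : realType) (N : nat) (A B C H : 'M[Cx R]_N) :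
  adjoint (A * (B * C)) * H * (A * (B * C)) =
  adjoint C * (adjoint B * (adjoint A * H * A) * B) * C.
Proof. by rewrite -!mulmxE !adjointM !mulmxA. Qed.

(* The 2p summation indices, in the order l_1, k_1, ..., l_p, k_p from the
   outermost to the innermost, are the successive entries of s. *)
Theorem lemma4p0p1 (R : realType) (n p : nat) (c : bits n -> R)
    (gamma beta : 'I_p -> R) (hp : (1 <= p)%N) :
  has_iterated_sum p.*2
    (fun s : seq nat =>
       qaoa_term c gamma beta
         (fun j : 'I_p => nth 0%N s j.*2) (fun j : 'I_p => nth 0%N s j.*2.+1))
    (adjoint (qaoa c gamma beta) * cost_hamiltonian c * qaoa c gamma beta).
Proof.
(* The induction starts with no layers, where the products are empty and both sides are the cost
   Hamiltonian. *)
elim: p gamma beta {hp} => [|p IHp] gamma beta.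
  rewrite /= /qaoa_term /qaoa_superop /qaoa !big_ord0 invr1 scale1r mulr1.
  by rewrite /adjoint trmx1 map_mx1 -!mulmxE mul1mx.
rewrite doubleS qaoa_recr adjoint_conjM.
(* The outermost index l_1 is split off, so entry 0 of the remaining [s] is k_1 and [behead s] holds
   the indices of the later layers. *)
apply: (has_iterated_sum_cons
  (f := ad_term (cost_hamiltonian c) (gamma ord0))
  (F := fun s => ad_term (mixing_hamiltonian R n) (beta ord0) (nth 0%N s 0)
    (qaoa_term c (gamma \o lift ord0) (beta \o lift ord0)
      (fun j : 'I_p => nth 0%N (behead s) j.*2)
      (fun j : 'I_p => nth 0%N (behead s) j.*2.+1)))).
- exact: ad_term_linear.
- move=> t s; rewrite qaoa_term_recl.
  (* Entries 2j+2 and 2j+3 of [t :: s] are entries 2j and 2j+1 of [behead s]. For empty [s] all of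
     these are the default 0. *)
  rewrite (_ : (fun j : 'I_p.+1 => nth 0%N (t :: s) j.*2) \o lift ord0
      = fun j : 'I_p => nth 0%N (behead s) j.*2); last first.
    by apply/funext => j; case: s => [|k s] //=; rewrite !nth_nil.
  rewrite (_ : (fun j : 'I_p.+1 => nth 0%N (t :: s) j.*2.+1) \o lift ord0
      = fun j : 'I_p => nth 0%N (behead s) j.*2.+1); last first.
    by apply/funext => j; case: s => [|k s] //=; rewrite !nth_nil.
  by [].
(* Next k_1 is split off; the sum inside it is the induction hypothesis for the later layers. *)
- apply: (has_iterated_sum_cons
    (f := ad_term (mixing_hamiltonian R n) (beta ord0))) (IHp _ _) _ => //.
  + exact: ad_term_linear.
  + exact/ad_series_cvg/mixing_hamiltonian_hermitian.
- exact/ad_series_cvg/cost_hamiltonian_hermitian.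
Qed.
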